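(* Let $(\mathcal A,\mathcal B)$ be a semi-orthogonal decomposition of a triangulated category $\mathcal C$. Consider the $\mathcal A$-$\mathcal B$-bimodule $\mathcal U$ with $\mathcal U(A,B)=\mathrm{Hom}_{\mathcal C}(A,B)$ for $A\in\mathcal A$, $B\in\mathcal B$. For every $f:A\to B$ with $A\in\mathcal A$, $B\in\mathcal B$ fix a cone $Cf$, that is, an exact triangle $A\xrightarrow{f}B\xrightarrow{f_1}Cf\xrightarrow{f_2}A[1]$. Then the map $f\mapsto Cf$ induces an equivalence of categories $\mathsf C:\mathrm{El}(\mathcal U)\to\mathcal C/\mathcal J$, where $\mathcal J$ is the ideal of $\mathcal C$ consisting of those morphisms $\eta$ for which there are factorizations $\eta=\eta'\xi=\zeta\eta''$ such that the source of $\eta'$ is in $\mathcal A$ and the target of $\eta''$ is in $\mathcal B$. Moreover, $\mathcal J^2=0$, so $\mathsf C$ induces a bijection between isomorphism classes of objects of $\mathrm{El}(\mathcal U)$ and of $\mathcal C$.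
   Context: A semi-orthogonal decomposition $\mathcal C=(\mathcal A,\mathcal B)$ means that $\mathcal A,\mathcal B$ are full triangulated subcategories of $\mathcal C$, that $\mathrm{Hom}_{\mathcal C}(B,A)=0$ for all $A\in\mathcal A$, $B\in\mathcal B$, and that for every object $T\in\mathcal C$ there is an exact triangle $A\to B\to T\to A[1]$ with $A\in\mathcal A$, $B\in\mathcal B$. For additive categories $\mathcal A,\mathcal B$, an $\mathcal A$-$\mathcal B$-bimodule is a biadditive functor $\mathcal U:\mathcal A^{\mathrm{op}}\times\mathcal B\to\mathbf{Ab}$. The bimodule category (category of elements) $\mathrm{El}(\mathcal U)$ has as objects the set $\bigcup_{A\in\mathcal A,B\in\mathcal B}\mathcal U(A,B)$; a morphism from $u\in\mathcal U(A,B)$ to $v\in\mathcal U(A',B')$ is a pair $(\alpha,\beta)$ with $\alpha:A\to A'$, $\beta:B\to B'$ and $v\alpha=\beta u$, where $v\alpha=\mathcal U(\alpha,1_{B'})v$ and $\beta u=\mathcal U(1_A,\beta)u$. The functor $\mathsf C$ sends a morphism $(\alpha,\beta):f\to f'$ to the class modulo $\mathcal J$ of any $\gamma:Cf\to Cf'$ completing $(\alpha,\beta)$ to a morphism of the fixed exact triangles. *)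

(* Defs.v *)
From HB Require Import structures.
From mathcomp Require Import all_boot all_algebra.
From mathcomp Require Import boolp classical_sets functions.

Set Implicit Arguments.
Unset Strict Implicit.
Unset Printing Implicit Defensive.

Import GRing.Theory.
Local Open Scope ring_scope.
Local Open Scope classical_set_scope.
Local Open Scope quotient_scope.

Reserved Notation "g \oc f" (at level 40, left associativity).

Record preadditive := Preadditive {
  ob :> Type;
  mor : ob -> ob -> zmodType;
  idm : forall X, mor X X;
  mcomp : forall X Y Z, mor Y Z -> mor X Y -> mor X Z;
  comp1f : forall X Y (f : mor X Y), mcomp (idm Y) f = f;
  compf1 : forall X Y (f : mor X Y), mcomp f (idm X) = f;
  compA : forall X Y Z W (h : mor Z W) (g : mor Y Z) (f : mor X Y),
    mcomp h (mcomp g f) = mcomp (mcomp h g) f;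
  compDl : forall X Y Z (g g' : mor Y Z) (f : mor X Y),
    mcomp (g + g') f = mcomp g f + mcomp g' f;
  compDr : forall X Y Z (g : mor Y Z) (f f' : mor X Y),
    mcomp g (f + f') = mcomp g f + mcomp g f' }.

Arguments mor {p} X Y.
Arguments idm {p} X.
Arguments mcomp {p X Y Z} g f.

Notation "g \oc f" := (mcomp g f).

Section PreadditiveTheory.
Variable C : preadditive.
Implicit Types X Y Z : C.

Definition is_iso X Y (f : mor X Y) :=
  exists g : mor Y X, g \oc f = idm X /\ f \oc g = idm Y.

Definition isomorphic X Y := exists f : mor X Y, is_iso f.

Definition is_zero_object Z :=
  forall X, (forall f : mor X Z, f = 0) /\ (forall f : mor Z X, f = 0).

Definition is_biproduct X Y S
    (i1 : mor X S) (i2 : mor Y S) (p1 : mor S X) (p2 : mor S Y) :=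
  [/\ p1 \oc i1 = idm X, p2 \oc i2 = idm Y, p1 \oc i2 = 0, p2 \oc i1 = 0
    & i1 \oc p1 + i2 \oc p2 = idm S].

Definition additive_category :=
  (exists Z, is_zero_object Z) /\
  (forall X Y, exists S i1 i2 p1 p2, @is_biproduct X Y S i1 i2 p1 p2).

Definition iso_closure (P : set C) : set C :=
  [set X | exists2 Y, P Y & isomorphic X Y].

Definition iso_class X : set C := [set Y | isomorphic X Y].

Definition iso_classes : set (set C) := range iso_class.

Lemma comp0l X Y Z (f : mor X Y) : (0 : mor Y Z) \oc f = 0.
Proof. by apply: (addrI (0 \oc f)); rewrite -compDl !addr0. Qed.

Lemma comp0r X Y Z (g : mor Y Z) : g \oc (0 : mor X Y) = 0.
Proof. by apply: (addrI (g \oc 0)); rewrite -compDr !addr0. Qed.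

Lemma compNl X Y Z (g : mor Y Z) (f : mor X Y) : (- g) \oc f = - (g \oc f).
Proof. by apply: (addrI (g \oc f)); rewrite -compDl !subrr comp0l. Qed.

Lemma compNr X Y Z (g : mor Y Z) (f : mor X Y) : g \oc (- f) = - (g \oc f).
Proof. by apply: (addrI (g \oc f)); rewrite -compDr !subrr comp0r. Qed.

Lemma compBl X Y Z (g g' : mor Y Z) (f : mor X Y) :
  (g - g') \oc f = g \oc f - g' \oc f.
Proof. by rewrite compDl compNl. Qed.

Lemma compBr X Y Z (g : mor Y Z) (f f' : mor X Y) :
  g \oc (f - f') = g \oc f - g \oc f'.
Proof. by rewrite compDr compNr. Qed.

End PreadditiveTheory.

(* The object map is a parameter, so that it can be prescribed on the nose. *)
Record functor_on (C D : preadditive) (F : C -> D) := FunctorOn {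
  fmap_on : forall X Y : C, mor X Y -> mor (F X) (F Y);
  fmap_on1 : forall X : C, fmap_on (idm X) = idm (F X);
  fmap_onM : forall (X Y Z : C) (g : mor Y Z) (f : mor X Y),
    fmap_on (g \oc f) = fmap_on g \oc fmap_on f }.

Record functor (C D : preadditive) := Functor {
  fobj :> C -> D;
  fon : functor_on fobj }.

Definition fmap (C D : preadditive) (F : functor C D) (X Y : C)
  (f : mor X Y) : mor (F X) (F Y) := fmap_on (fon F) f.

Arguments fmap {C D} F {X Y} f.

Definition additive_functor (C D : preadditive) (F : functor C D) :=
  forall (X Y : C) (f g : mor X Y), fmap F (f + g) = fmap F f + fmap F g.

Definition idF_on (C : preadditive) : functor_on (fun X : C => X) :=
  @FunctorOn C C (fun X => X) (fun _ _ f => f)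
    (fun _ => erefl) (fun _ _ _ _ _ => erefl).

Definition idF (C : preadditive) : functor C C := Functor (idF_on C).

Section CompF.
Variables (C D E : preadditive) (G : functor D E) (F : functor C D).

Definition compF_map (X Y : C) (f : mor X Y) : mor (G (F X)) (G (F Y)) :=
  fmap G (fmap F f).

Lemma compF_map1 (X : C) : compF_map (idm X) = idm (G (F X)).
Proof. by rewrite /compF_map /fmap !fmap_on1. Qed.

Lemma compF_mapM (X Y Z : C) (g : mor Y Z) (f : mor X Y) :
  compF_map (g \oc f) = compF_map g \oc compF_map f.
Proof. by rewrite /compF_map /fmap !fmap_onM. Qed.

Definition compF : functor C E := Functor (FunctorOn compF_map1 compF_mapM).

End CompF.

Definition naturally_isomorphic (C D : preadditive) (F G : functor C D) :=
  exists eta : forall X : C, mor (F X) (G X),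
    (forall X, is_iso (eta X)) /\
    (forall (X Y : C) (f : mor X Y), eta Y \oc fmap F f = fmap G f \oc eta X).

Definition is_equivalence (C D : preadditive) (F : functor C D) :=
  exists G : functor D C,
    naturally_isomorphic (compF G F) (idF C) /\
    naturally_isomorphic (compF F G) (idF D).

Definition full_sub (C : preadditive) (P : set C) : preadditive :=
  @Preadditive {X : C | P X} (fun X Y => mor (sval X) (sval Y))
    (fun X => idm (sval X)) (fun _ _ _ g f => g \oc f)
    (fun _ _ f => comp1f f) (fun _ _ f => compf1 f)
    (fun _ _ _ _ h g f => compA h g f)
    (fun _ _ _ g g' f => compDl g g' f) (fun _ _ _ g f f' => compDr g f f').

Record ideal (C : preadditive) := Ideal {
  ideal_mem : forall X Y : C, set (mor X Y);
  ideal0 : forall X Y, ideal_mem (0 : mor X Y);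
  idealB : forall X Y (f g : mor X Y),
    ideal_mem f -> ideal_mem g -> ideal_mem (f - g);
  idealMl : forall X Y Z (g : mor Y Z) (f : mor X Y),
    ideal_mem f -> ideal_mem (g \oc f);
  idealMr : forall X Y Z (g : mor Y Z) (f : mor X Y),
    ideal_mem g -> ideal_mem (g \oc f) }.

Arguments ideal_mem {C} i {X Y} _.

(* Membership in the product ideal: finite sums of composites. *)
Definition ideal_mul (C : preadditive) (I J : ideal C) (X Y : C) :
    set (mor X Y) :=
  [set h | exists (n : nat) (Z : 'I_n -> C)
      (g : forall i, mor (Z i) Y) (f : forall i, mor X (Z i)),
    [/\ forall i, ideal_mem I (g i), forall i, ideal_mem J (f i)
      & h = \sum_(i < n) g i \oc f i]].

Section Quotient.
Variables (C : preadditive) (I : ideal C).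

Definition ideal_pred (X Y : C) : {pred mor X Y} := fun f => `[< ideal_mem I f >].

Arguments ideal_pred : clear implicits.

Lemma ideal_predP (X Y : C) (f : mor X Y) : f \in ideal_pred X Y <-> ideal_mem I f.
Proof. by split=> [/asboolP|/asboolP]. Qed.

Lemma ideal_pred_zmod_closed (X Y : C) : zmod_closed (ideal_pred X Y).
Proof.
split; first by apply/ideal_predP/ideal0.
by move=> f g /ideal_predP If /ideal_predP Ig; apply/ideal_predP/idealB.
Qed.

HB.instance Definition _ (X Y : C) :=
  GRing.isZmodClosed.Build (mor X Y) (ideal_pred X Y)
    (ideal_pred_zmod_closed X Y).

Definition qhom (X Y : C) : zmodType := Quotient.quot (ideal_pred X Y).

Definition qpi (X Y : C) (f : mor X Y) : qhom X Y :=
  \pi_(Quotient.quot (ideal_pred X Y)) f.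

Lemma qpiK (X Y : C) (q : qhom X Y) : exists f, q = qpi f.
Proof. by exists (repr q); rewrite /qpi reprK. Qed.

Lemma qpi_eq (X Y : C) (f g : mor X Y) : qpi f = qpi g <-> ideal_mem I (f - g).
Proof.
rewrite -ideal_predP Quotient.idealrBE; split=> [h|/eqP//].
by apply/eqP.
Qed.

Lemma qpiD (X Y : C) (f g : mor X Y) : qpi (f + g) = qpi f + qpi g.
Proof. by rewrite /qpi; exact: raddfD. Qed.

Definition qcomp (X Y Z : C) (g : qhom Y Z) (f : qhom X Y) : qhom X Z :=
  qpi (repr g \oc repr f).

Lemma qcompE (X Y Z : C) (g : mor Y Z) (f : mor X Y) :
  qcomp (qpi g) (qpi f) = qpi (g \oc f).
Proof.
apply/qpi_eq.
set g' := repr _; set f' := repr _.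
have Ig : ideal_mem I (g' - g) by apply/qpi_eq; rewrite /qpi reprK.
have If : ideal_mem I (f - f') by apply/qpi_eq; rewrite /qpi reprK.
have -> : g' \oc f' - g \oc f = (g' - g) \oc f' - g \oc (f - f').
  by rewrite compBl compBr opprB addrA addrNK.
by apply: idealB; [apply: idealMr|apply: idealMl].
Qed.

Lemma qcomp1f (X Y : C) (f : qhom X Y) : qcomp (qpi (idm Y)) f = f.
Proof. by have [f' ->] := qpiK f; rewrite qcompE comp1f. Qed.

Lemma qcompf1 (X Y : C) (f : qhom X Y) : qcomp f (qpi (idm X)) = f.
Proof. by have [f' ->] := qpiK f; rewrite qcompE compf1. Qed.

Lemma qcompA (X Y Z W : C) (h : qhom Z W) (g : qhom Y Z) (f : qhom X Y) :
  qcomp h (qcomp g f) = qcomp (qcomp h g) f.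
Proof.
have [f' ->] := qpiK f; have [g' ->] := qpiK g; have [h' ->] := qpiK h.
by rewrite !qcompE compA.
Qed.

Lemma qcompDl (X Y Z : C) (g g' : qhom Y Z) (f : qhom X Y) :
  qcomp (g + g') f = qcomp g f + qcomp g' f.
Proof.
have [a ->] := qpiK f; have [b ->] := qpiK g; have [b' ->] := qpiK g'.
by rewrite -qpiD !qcompE compDl qpiD.
Qed.

Lemma qcompDr (X Y Z : C) (g : qhom Y Z) (f f' : qhom X Y) :
  qcomp g (f + f') = qcomp g f + qcomp g f'.
Proof.
have [a ->] := qpiK f; have [a' ->] := qpiK f'; have [b ->] := qpiK g.
by rewrite -qpiD !qcompE compDr qpiD.
Qed.

Definition quotient_cat : preadditive :=
  @Preadditive (ob C) qhom (fun X => qpi (idm X)) qcomp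
    qcomp1f qcompf1 qcompA qcompDl qcompDr.

Definition quotient_class (X Y : C) (f : mor X Y) :
  @mor quotient_cat X Y := qpi f.

End Quotient.

(* A biadditive functor from A^op x B to abelian groups. *)
Record bimodule (A B : preadditive) := Bimodule {
  bimod :> A -> B -> zmodType;
  bimap : forall (X X' : A) (Y Y' : B),
    mor X' X -> mor Y Y' -> bimod X Y -> bimod X' Y';
  bimap1 : forall (X : A) (Y : B) (u : bimod X Y),
    bimap (idm X) (idm Y) u = u;
  bimapM : forall (X X' X'' : A) (Y Y' Y'' : B)
      (a : mor X' X) (a' : mor X'' X') (b : mor Y Y') (b' : mor Y' Y'')
      (u : bimod X Y),
    bimap (a \oc a') (b' \oc b) u = bimap a' b' (bimap a b u);
  bimapD : forall (X X' : A) (Y Y' : B) (a : mor X' X) (b : mor Y Y')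
      (u u' : bimod X Y),
    bimap a b (u + u') = bimap a b u + bimap a b u';
  bimapDl : forall (X X' : A) (Y Y' : B) (a a' : mor X' X) (b : mor Y Y')
      (u : bimod X Y),
    bimap (a + a') b u = bimap a b u + bimap a' b u;
  bimapDr : forall (X X' : A) (Y Y' : B) (a : mor X' X) (b b' : mor Y Y')
      (u : bimod X Y),
    bimap a (b + b') u = bimap a b u + bimap a b' u }.

Arguments bimap {A B} _ {X X' Y Y'} _ _ _.

Section Elements.
Variables (A B : preadditive) (U : bimodule A B).

Record el := El { el_src : A; el_tgt : B; el_val : U el_src el_tgt }.

Definition el_pred (u v : el) :
    {pred mor (el_src u) (el_src v) * mor (el_tgt u) (el_tgt v)} :=
  fun p => bimap U p.1 (idm (el_tgt v)) (el_val v) ==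
           bimap U (idm (el_src u)) p.2 (el_val u).

Arguments el_pred : clear implicits.

Lemma bimap0l (X X' : A) (Y Y' : B) (b : mor Y Y') (u : U X Y) :
  bimap U (0 : mor X' X) b u = 0.
Proof. by apply: (addrI (bimap U 0 b u)); rewrite -bimapDl !addr0. Qed.

Lemma bimap0r (X X' : A) (Y Y' : B) (a : mor X' X) (u : U X Y) :
  bimap U a (0 : mor Y Y') u = 0.
Proof. by apply: (addrI (bimap U a 0 u)); rewrite -bimapDr !addr0. Qed.

Lemma bimapNl (X X' : A) (Y Y' : B) (a : mor X' X) (b : mor Y Y')
  (u : U X Y) : bimap U (- a) b u = - bimap U a b u.
Proof. by apply: (addrI (bimap U a b u)); rewrite -bimapDl !subrr bimap0l. Qed.

Lemma bimapNr (X X' : A) (Y Y' : B) (a : mor X' X) (b : mor Y Y')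
  (u : U X Y) : bimap U a (- b) u = - bimap U a b u.
Proof. by apply: (addrI (bimap U a b u)); rewrite -bimapDr !subrr bimap0r. Qed.

Lemma el_pred_zmod_closed (u v : el) : zmod_closed (el_pred u v).
Proof.
split; first by rewrite unfold_in /= bimap0l bimap0r.
move=> p q; rewrite !unfold_in /= => /eqP hp /eqP hq.
by rewrite bimapDl bimapDr bimapNl bimapNr hp hq.
Qed.

HB.instance Definition _ (u v : el) :=
  GRing.isZmodClosed.Build
    (mor (el_src u) (el_src v) * mor (el_tgt u) (el_tgt v))%type
    (el_pred u v) (el_pred_zmod_closed u v).

Record el_hom (u v : el) := ElHom {
  el_pair : mor (el_src u) (el_src v) * mor (el_tgt u) (el_tgt v);
  el_pairP : el_pair \in el_pred u v }.

HB.instance Definition _ (u v : el) := [isSub for @el_pair u v].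
HB.instance Definition _ (u v : el) := [Choice of el_hom u v by <:].
HB.instance Definition _ (u v : el) :=
  [SubChoice_isSubZmodule of el_hom u v by <:].

Lemma el_id_subproof (u : el) :
  (idm (el_src u), idm (el_tgt u)) \in el_pred u u.
Proof. by rewrite unfold_in. Qed.

Definition el_id (u : el) : el_hom u u := ElHom (el_id_subproof u).

Lemma el_comp_subproof (u v w : el) (g : el_hom v w) (f : el_hom u v) :
  ((el_pair g).1 \oc (el_pair f).1, (el_pair g).2 \oc (el_pair f).2)
    \in el_pred u w.
Proof.
case: g => [[ga gb] /= hg]; case: f => [[fa fb] /= hf].
move: hg hf; rewrite !unfold_in /= => /eqP hg /eqP hf; apply/eqP.
rewrite -[X in bimap U _ X _ = _](comp1f (idm (el_tgt w))) bimapM hg.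
rewrite -bimapM !comp1f.
have -> : bimap U fa gb (el_val v) =
    bimap U (idm _) gb (bimap U fa (idm _) (el_val v)).
  by rewrite -bimapM !compf1.
by rewrite hf -bimapM compf1.
Qed.

Definition el_comp (u v w : el) (g : el_hom v w) (f : el_hom u v) :
  el_hom u w := ElHom (el_comp_subproof g f).

Lemma el_comp1f (u v : el) (f : el_hom u v) : el_comp (el_id v) f = f.
Proof. by apply: val_inj; rewrite /= !comp1f -surjective_pairing. Qed.

Lemma el_compf1 (u v : el) (f : el_hom u v) : el_comp f (el_id u) = f.
Proof. by apply: val_inj; rewrite /= !compf1 -surjective_pairing. Qed.

Lemma el_compA (u v w x : el) (h : el_hom w x) (g : el_hom v w)
  (f : el_hom u v) : el_comp h (el_comp g f) = el_comp (el_comp h g) f.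
Proof. by apply: val_inj; rewrite /= !compA. Qed.

Lemma el_compDl (u v w : el) (g g' : el_hom v w) (f : el_hom u v) :
  el_comp (g + g') f = el_comp g f + el_comp g' f.
Proof. by apply: val_inj; rewrite /= !compDl. Qed.

Lemma el_compDr (u v w : el) (g : el_hom v w) (f f' : el_hom u v) :
  el_comp g (f + f') = el_comp g f + el_comp g f'.
Proof. by apply: val_inj; rewrite /= !compDr. Qed.

Definition elements : preadditive :=
  @Preadditive el (fun u v => el_hom u v : zmodType) el_id el_comp
    el_comp1f el_compf1 el_compA el_compDl el_compDr.

End Elements.

(* [exact_tri f g h] says that X -f-> Y -g-> Z -h-> X[1] is an exact triangle.  The
   shift is an additive autoequivalence, not necessarily an automorphism. *)
Record triangulated := Triangulated {
  tcat :> preadditive;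
  tcat_additive : additive_category tcat;
  shiftF : functor tcat tcat;
  shift_additive : additive_functor shiftF;
  shift_equivalence : is_equivalence shiftF;
  exact_tri : forall X Y Z : tcat,
    mor X Y -> mor Y Z -> mor Z (shiftF X) -> Prop;
  dist_iso : forall (X Y Z X' Y' Z' : tcat)
      (f : mor X Y) (g : mor Y Z) (h : mor Z (shiftF X))
      (f' : mor X' Y') (g' : mor Y' Z') (h' : mor Z' (shiftF X'))
      (u : mor X X') (v : mor Y Y') (w : mor Z Z'),
    is_iso u -> is_iso v -> is_iso w ->
    v \oc f = f' \oc u -> w \oc g = g' \oc v -> fmap shiftF u \oc h = h' \oc w ->
    exact_tri f g h -> exact_tri f' g' h';
  dist_id : forall X Z : tcat, is_zero_object Z ->
    exact_tri (idm X) (0 : mor X Z) (0 : mor Z (shiftF X));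
  dist_complete : forall (X Y : tcat) (f : mor X Y),
    exists Z (g : mor Y Z) (h : mor Z (shiftF X)), exact_tri f g h;
  dist_rotate : forall (X Y Z : tcat)
      (f : mor X Y) (g : mor Y Z) (h : mor Z (shiftF X)),
    exact_tri f g h <-> exact_tri g h (- fmap shiftF f);
  dist_morphism : forall (X Y Z X' Y' Z' : tcat)
      (f : mor X Y) (g : mor Y Z) (h : mor Z (shiftF X))
      (f' : mor X' Y') (g' : mor Y' Z') (h' : mor Z' (shiftF X'))
      (u : mor X X') (v : mor Y Y'),
    exact_tri f g h -> exact_tri f' g' h' -> v \oc f = f' \oc u ->
    exists w : mor Z Z',
      w \oc g = g' \oc v /\ fmap shiftF u \oc h = h' \oc w;
  dist_octahedron : forall (X Y Z Q1 Q2 Q3 : tcat)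
      (f : mor X Y) (g : mor Y Z)
      (p1 : mor Y Q1) (d1 : mor Q1 (shiftF X))
      (p2 : mor Z Q2) (d2 : mor Q2 (shiftF X))
      (p3 : mor Z Q3) (d3 : mor Q3 (shiftF Y)),
    exact_tri f p1 d1 -> exact_tri (g \oc f) p2 d2 -> exact_tri g p3 d3 ->
    exists (a : mor Q1 Q2) (b : mor Q2 Q3),
      [/\ exact_tri a b (fmap shiftF p1 \oc d3),
          a \oc p1 = p2 \oc g, d2 \oc a = d1,
          b \oc p2 = p3 & d3 \oc b = fmap shiftF f \oc d2] }.

Arguments shiftF {t}.
Arguments exact_tri {t X Y Z} f g h.

Section SemiOrthogonal.
Variable C : triangulated.
Implicit Types P A B : set C.

(* Full additive subcategory stable under shifts and cones, all up to
   isomorphism, so that it need not be closed under isomorphisms. *)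
Definition triangulated_subcategory P :=
  [/\ exists2 Z, P Z & is_zero_object Z,
      forall (X Y S : C) i1 i2 p1 p2, P X -> P Y ->
        @is_biproduct C X Y S i1 i2 p1 p2 -> iso_closure P S,
      forall X, P X -> iso_closure P (shiftF X),
      forall X, P X -> exists2 Y, P Y & isomorphic X (shiftF Y)
    & forall (X Y Z : C) (f : mor X Y) (g : mor Y Z) (h : mor Z (shiftF X)),
        exact_tri f g h -> P X -> P Y -> iso_closure P Z].

Definition semi_orthogonal A B :=
  [/\ triangulated_subcategory A, triangulated_subcategory B,
      forall X Y, A X -> B Y -> forall f : mor Y X, f = 0
    & forall T : C, exists X Y,
        [/\ A X, B Y & exists (f : mor X Y) (g : mor Y T)
          (h : mor T (shiftF X)), exact_tri f g h]].

Definition factors_through P (X Y : C) (f : mor X Y) :=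
  exists Z, P Z /\ exists (g : mor Z Y) (h : mor X Z), f = g \oc h.

Lemma factors_through0 P (X Y : C) :
  triangulated_subcategory P -> factors_through P (0 : mor X Y).
Proof.
by case=> -[Z PZ _] _ _ _ _; exists Z; split=> //; exists 0, 0; rewrite comp0l.
Qed.

Lemma factors_throughB P (X Y : C) (f f' : mor X Y) :
  triangulated_subcategory P ->
  factors_through P f -> factors_through P f' -> factors_through P (f - f').
Proof.
case=> _ Psum _ _ _ [Z [PZ [g [h ->]]]] [Z' [PZ' [g' [h' ->]]]].
have [_ /(_ Z Z') [S [i1 [i2 [p1 [p2 bi]]]]]] := tcat_additive C.
have [S' PS' [k [l [lk _]]]] := Psum _ _ _ _ _ _ _ PZ PZ' bi.
case: bi => p1i1 p2i2 p1i2 p2i1 _.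
exists S'; split=> //.
exists ((g \oc p1 - g' \oc p2) \oc l), (k \oc (i1 \oc h + i2 \oc h')).
rewrite compA -(compA _ l k) lk compf1 compDr !compBl.
rewrite -!compA (compA p1 i1) (compA p2 i1) (compA p1 i2) (compA p2 i2).
by rewrite p1i1 p2i1 p1i2 p2i2 !comp1f !comp0l !comp0r subr0 sub0r.
Qed.

Variables (A B : set C) (sod : semi_orthogonal A B).

Definition sod_mem (X Y : C) : set (mor X Y) :=
  [set f | factors_through A f /\ factors_through B f].

Lemma sod_mem0 (X Y : C) : sod_mem (0 : mor X Y).
Proof. by case: sod => tA tB _ _; split; apply: factors_through0. Qed.

Lemma sod_memB (X Y : C) (f g : mor X Y) :
  sod_mem f -> sod_mem g -> sod_mem (f - g).
Proof.
by case: sod => tA tB _ _ [fA fB] [gA gB]; split; apply: factors_throughB.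
Qed.

Lemma sod_memMl (X Y Z : C) (g : mor Y Z) (f : mor X Y) :
  sod_mem f -> sod_mem (g \oc f).
Proof.
move=> [[S [PS [k [l ->]]]] [S' [PS' [k' [l' e]]]]]; split.
  by exists S; split=> //; exists (g \oc k), l; rewrite compA.
by rewrite e; exists S'; split=> //; exists (g \oc k'), l'; rewrite compA.
Qed.

Lemma sod_memMr (X Y Z : C) (g : mor Y Z) (f : mor X Y) :
  sod_mem g -> sod_mem (g \oc f).
Proof.
move=> [[S [PS [k [l ->]]]] [S' [PS' [k' [l' e]]]]]; split.
  by exists S; split=> //; exists k, (l \oc f); rewrite compA.
by rewrite e; exists S'; split=> //; exists k', (l' \oc f); rewrite compA.
Qed.

Definition sod_ideal : ideal C :=
  Ideal sod_mem0 sod_memB sod_memMl sod_memMr.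

End SemiOrthogonal.

Section HomBimodule.
Variables (C : preadditive) (A B : set C).

Definition hom_bimap (X X' : full_sub A) (Y Y' : full_sub B)
    (a : mor X' X) (b : mor Y Y') (u : @mor C (sval X) (sval Y)) :
    @mor C (sval X') (sval Y') :=
  @mcomp C _ _ _ b (@mcomp C _ _ _ u a).

Lemma hom_bimap1 (X : full_sub A) (Y : full_sub B)
  (u : @mor C (sval X) (sval Y)) : hom_bimap (idm X) (idm Y) u = u.
Proof. by rewrite /hom_bimap /= compf1 comp1f. Qed.

Lemma hom_bimapM (X X' X'' : full_sub A) (Y Y' Y'' : full_sub B)
    (a : mor X' X) (a' : mor X'' X') (b : mor Y Y') (b' : mor Y' Y'')
    (u : @mor C (sval X) (sval Y)) :
  hom_bimap (a \oc a') (b' \oc b) u = hom_bimap a' b' (hom_bimap a b u).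
Proof. by rewrite /hom_bimap /= !compA. Qed.

Lemma hom_bimapD (X X' : full_sub A) (Y Y' : full_sub B)
    (a : mor X' X) (b : mor Y Y') (u u' : @mor C (sval X) (sval Y)) :
  hom_bimap a b (u + u') = hom_bimap a b u + hom_bimap a b u'.
Proof. by rewrite /hom_bimap compDl compDr. Qed.

Lemma hom_bimapDl (X X' : full_sub A) (Y Y' : full_sub B)
    (a a' : mor X' X) (b : mor Y Y') (u : @mor C (sval X) (sval Y)) :
  hom_bimap (a + a') b u = hom_bimap a b u + hom_bimap a' b u.
Proof. by rewrite /hom_bimap !compDr. Qed.

Lemma hom_bimapDr (X X' : full_sub A) (Y Y' : full_sub B)
    (a : mor X' X) (b b' : mor Y Y') (u : @mor C (sval X) (sval Y)) :
  hom_bimap a (b + b') u = hom_bimap a b u + hom_bimap a b' u.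
Proof. by rewrite /hom_bimap compDl. Qed.

Definition hom_bimodule : bimodule (full_sub A) (full_sub B) :=
  @Bimodule (full_sub A) (full_sub B)
    (fun X Y => @mor C (sval X) (sval Y)) hom_bimap
    hom_bimap1 hom_bimapM hom_bimapD hom_bimapDl hom_bimapDr.

End HomBimodule.

Section HomElements.
Variables (C : preadditive) (A B : set C).
Local Notation El := (elements (hom_bimodule A B)).

Definition arr_src (u : El) : C := sval (el_src u).
Definition arr_tgt (u : El) : C := sval (el_tgt u).
Definition arr (u : El) : mor (arr_src u) (arr_tgt u) := el_val u.

Definition arr_fst (u v : El) (p : mor u v) : mor (arr_src u) (arr_src v) :=
  (el_pair p).1.
Definition arr_snd (u v : El) (p : mor u v) : mor (arr_tgt u) (arr_tgt v) :=
  (el_pair p).2.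

End HomElements.

(* Main.v *)
Require Import Defs.
From mathcomp Require Import all_boot all_algebra.
From mathcomp Require Import boolp classical_sets functions.

(** The orthogonality Hom(B, A) = 0 rigidifies the triangles
    A -> B -> Cf -> A[1] attached to the arrows f : A -> B.

    Uniqueness. Two completions c, c' of a square (a, b) : f -> f' differ by
    a morphism killed by f1 on the right and by f2' on the left.  By the long
    exact Hom sequences it factors through f2, hence through A[1], and through
    f1', hence through B' ([cone_map_unique]).  So c is determined modulo J,
    and the functor exists.

    Fullness. For any c : Cf -> Cf' the composite f2' c f1 goes from B to
    A'[1], so it vanishes because A is stable under shifts, and c restricts
    along f1 to some b : B -> B'; the axiom on morphisms of triangles supplies
    a : A -> A' ([cone_map_full]).

    Faithfulness. If c is in J, then c f1 = 0, because c f1 factors through a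
    morphism from B to an object of A, and dually f2' c = 0.  Exactness then
    makes b factor through a morphism B -> A', and a[1] through a morphism
    B[1] -> A'[1]; both of these are zero ([cone_map_faithful]).

    Density. The triangle A -> B -> T -> A[1] of the decomposition exhibits T
    as a cone, and cones are unique up to isomorphism ([cone_isomorphic]).

    Finally, a composite of two members of J passes through a morphism from an
    object of B to an object of A, whence J^2 = 0.  An endomorphism that is
    the identity modulo a square-zero ideal is invertible, so isomorphisms
    lift along C -> C/J ([quotient_isomorphic]), and the equivalence gives a
    bijection on isomorphism classes already at the level of C. *)

Set Implicit Arguments.
Unset Strict Implicit.
Unset Printing Implicit Defensive.

Import GRing.Theory.
Local Open Scope ring_scope.
Local Open Scope classical_set_scope.

(** * Isomorphisms *)

Section Isomorphisms.
Variable C : preadditive.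
Implicit Types X Y Z : C.

Lemma isomorphic_refl X : isomorphic X X.
Proof. by exists (idm X), (idm X); rewrite comp1f. Qed.

Lemma isomorphic_sym X Y : isomorphic X Y -> isomorphic Y X.
Proof. by case=> f [g [gf fg]]; exists g, f. Qed.

Lemma isomorphic_trans Y X Z :
  isomorphic X Y -> isomorphic Y Z -> isomorphic X Z.
Proof.
case=> f [f' [f'f ff']] [g [g' [g'g gg']]].
exists (g \oc f), (f' \oc g'); split.
  by rewrite -Defs.compA (Defs.compA g' g) g'g comp1f.
by rewrite -Defs.compA (Defs.compA f f') ff' comp1f.
Qed.

Lemma iso_class_eq X Y : iso_class X = iso_class Y <-> isomorphic X Y.
Proof.
split=> [e|iXY]; first by have: iso_class Y Y := isomorphic_refl Y; rewrite -e.
apply/seteqP; split=> Z; last exact: isomorphic_trans.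
by apply: isomorphic_trans; apply: isomorphic_sym.
Qed.

(** If n is square-zero then 1 - n inverts 1 + n.  Applied to f g and g f this
    turns an inverse up to square-zero errors into one-sided inverses of f. *)
Lemma is_iso_square_zero X Y (f : mor X Y) (g : mor Y X) :
    (g \oc f - idm X) \oc (g \oc f - idm X) = 0 ->
    (f \oc g - idm Y) \oc (f \oc g - idm Y) = 0 ->
  is_iso f.
Proof.
have unip Z (e : mor Z Z) : (e - idm Z) \oc (e - idm Z) = 0 ->
    (idm Z - (e - idm Z)) \oc e = idm Z /\ e \oc (idm Z - (e - idm Z)) = idm Z.
  move: (e - idm Z) (subrK (idm Z) e) => n <- nn.
  rewrite !compBl !compBr !compDl !compDr !compf1 !comp1f nn !add0r.
  by rewrite (addrC n) addrK.
move=> /unip [gf _] /unip [_ fg].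
set l := _ - _ in gf; set r := _ - _ in fg.
rewrite Defs.compA in gf; rewrite -Defs.compA in fg.
have lr : l \oc g = g \oc r.
  by rewrite -[l \oc g]compf1 -fg Defs.compA gf comp1f.
by exists (l \oc g); split=> //; rewrite lr.
Qed.

End Isomorphisms.

(** * Fully faithful functors and equivalences *)

Definition full_functor (C D : preadditive) (F : functor C D) :=
  forall (X Y : C) (g : mor (F X) (F Y)), exists f : mor X Y, fmap F f = g.

Definition faithful_functor (C D : preadditive) (F : functor C D) :=
  forall (X Y : C) (f f' : mor X Y), fmap F f = fmap F f' -> f = f'.

Definition dense_functor (C D : preadditive) (F : functor C D) :=
  forall Y : D, exists X : C, isomorphic (F X) Y.

Lemma fmap1 (C D : preadditive) (F : functor C D) (X : C) :
  fmap F (idm X) = idm (F X).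
Proof. exact: fmap_on1. Qed.

Lemma fmapM (C D : preadditive) (F : functor C D) (X Y Z : C)
  (g : mor Y Z) (f : mor X Y) : fmap F (g \oc f) = fmap F g \oc fmap F f.
Proof. exact: fmap_onM. Qed.

Lemma left_inverse_faithful (C D : preadditive)
    (F : functor C D) (G : functor D C) :
  naturally_isomorphic (compF G F) (idF C) -> faithful_functor F.
Proof.
case=> eta [iso_eta nat_eta] X Y f f' eFf.
have [k [_ etak]] := iso_eta X.
have := nat_eta _ _ f; have := nat_eta _ _ f'.
rewrite /fmap /= /compF_map eFf => -> e.
by rewrite -[f]compf1 -[f']compf1 -etak !Defs.compA e.
Qed.

Section Equivalences.
Variables (C D : preadditive).

(** Given g : F X -> F Y, conjugating G g by the isomorphism of G F with the
    identity gives f : X -> Y with G (F f) = G g, and G is faithful as well. *)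
Lemma equivalence_full (F : functor C D) : is_equivalence F -> full_functor F.
Proof.
case=> G [GF FG] X Y g; have Gfaith := left_inverse_faithful FG.
case: GF => eta [iso_eta nat_eta].
have [k [keta etak]] := iso_eta X; have [l [leta _]] := iso_eta Y.
have etaI (W : C) (x y : mor W (G (F Y))) : eta Y \oc x = eta Y \oc y -> x = y.
  by move=> e; rewrite -[x]comp1f -[y]comp1f -leta -!Defs.compA e.
exists (eta Y \oc fmap G g \oc k); apply: Gfaith.
have e : eta Y \oc fmap G (fmap F (eta Y \oc fmap G g \oc k)) =
    eta Y \oc fmap G g \oc k \oc eta X := nat_eta _ _ _.
rewrite -(Defs.compA _ k) keta compf1 in e.
exact: etaI e.
Qed.

Lemma equivalence_faithful (F : functor C D) :
  is_equivalence F -> faithful_functor F.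
Proof. by case=> G [GF _]; apply: left_inverse_faithful GF. Qed.

Lemma fully_faithful_is_iso (F : functor C D) (X Y : C) (f : mor X Y) :
    full_functor F -> faithful_functor F ->
  is_iso (fmap F f) -> is_iso f.
Proof.
move=> Ffull Ffaith [k [kf fk]]; have [g eg] := Ffull _ _ k.
by exists g; split; apply: Ffaith; rewrite fmapM fmap1 eg.
Qed.

Lemma fully_faithful_isomorphic (F : functor C D) (X Y : C) :
    full_functor F -> faithful_functor F ->
  isomorphic (F X) (F Y) <-> isomorphic X Y.
Proof.
move=> Ffull Ffaith; split=> [[k isok]|[f [g [gf fg]]]].
  have [f ef] := Ffull _ _ k; exists f.
  by apply: (@fully_faithful_is_iso F) => //; rewrite ef.
by exists (fmap F f), (fmap F g); rewrite -!fmapM gf fg !fmap1.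
Qed.

Lemma fully_faithful_dense_equivalence (F : functor C D) :
    full_functor F -> faithful_functor F -> dense_functor F ->
  is_equivalence F.
Proof.
move=> Ffull Ffaith /choice [G /(_ _) /cid -/all_sig [e e_iso]].
have /all_sig [k keK] Y := cid (e_iso Y).
have lift (X Y : D) (f : mor X Y) := cid (Ffull _ _ (k Y \oc f \oc e X)).
pose Gm X Y f := sval (lift X Y f).
have GmE X Y f : fmap F (Gm X Y f) = k Y \oc f \oc e X := svalP (lift X Y f).
have Gm1 X : Gm X X (idm X) = idm (G X).
  by apply: Ffaith; rewrite GmE fmap1 compf1 (keK X).1.
have GmM X Y Z (g : mor Y Z) (f : mor X Y) :
    Gm X Z (g \oc f) = Gm Y Z g \oc Gm X Y f.
  apply: Ffaith; rewrite fmapM !GmE !Defs.compA -(Defs.compA _ (e Y)) (keK Y).2.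
  by rewrite compf1.
exists (Functor (FunctorOn Gm1 GmM)); split.
  have /all_sig [t tE] X := cid (Ffull (G (F X)) X (e (F X))).
  exists t; split=> [X|X Y f].
    apply: (fully_faithful_is_iso Ffull Ffaith); rewrite tE.
    by exists (k (F X)); apply: keK.
  apply: Ffaith; rewrite !fmapM !tE [fmap F (fmap _ f)]GmE.
  by rewrite !Defs.compA (keK _).2 comp1f.
exists e; split=> // X Y f.
by rewrite [fmap (compF _ _) f]GmE !Defs.compA (keK _).2 comp1f.
Qed.

End Equivalences.

(** * Square-zero ideals *)

Section SquareZero.
Variables (C : preadditive) (I : ideal C).

Lemma quotient_isomorphic (X Y : C) :
    (forall (X Y Z : C) (g : mor Y Z) (f : mor X Y),
      ideal_mem I g -> ideal_mem I f -> g \oc f = 0) ->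
  @isomorphic (quotient_cat I) X Y <-> isomorphic X Y.
Proof.
move=> I2; split=> [[q [r [rq qr]]]|[f [g [gf fg]]]]; last first.
  exists (quotient_class I f), (quotient_class I g).
  by split; rewrite /= qcompE ?gf ?fg.
have [f ef] := qpiK q; have [g eg] := qpiK r.
rewrite ef eg /= !qcompE in rq qr.
move/qpi_eq in rq; move/qpi_eq in qr.
by exists f; apply: (is_iso_square_zero (g := g)); apply: I2.
Qed.

End SquareZero.

(** * Exact triangles *)

Section Triangles.
Variable C : triangulated.
Implicit Types W X Y Z : C.

Lemma shift_full : full_functor (@shiftF C).
Proof. exact: equivalence_full (shift_equivalence C). Qed.

Lemma shift_faithful : faithful_functor (@shiftF C).
Proof. exact: equivalence_faithful (shift_equivalence C). Qed.

Lemma shift0 X Y : fmap shiftF (0 : mor X Y) = 0.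
Proof.
by apply: (addrI (fmap shiftF 0)); rewrite -(@shift_additive C) !addr0.
Qed.

Lemma shift_zero_object Z : is_zero_object Z -> is_zero_object (shiftF Z).
Proof.
move=> /(_ Z) [Z0 _] X.
have id0 : idm (shiftF Z) = 0 by rewrite -fmap1 (Z0 (idm Z)) shift0.
split=> f; first by rewrite -[f]comp1f id0 comp0l.
by rewrite -[f]compf1 id0 comp0r.
Qed.

Section Exactness.
Variables (X Y Z : C) (f : mor X Y) (g : mor Y Z) (h : mor Z (shiftF X)).
Hypothesis tri : exact_tri f g h.

(** Compare W -> 0 -> W[1] with the rotated triangle: the completion of
    (k, 0) is a shifted factorization of k. *)
Lemma exact_lift W (k : mor W Y) : g \oc k = 0 -> exists m, k = f \oc m.
Proof.
move=> gk; have [[Z0 Z0P] _] := tcat_additive C.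
have triW := (dist_rotate _ _ _).1 (dist_id W Z0P).
have sq : (0 : mor Z0 Z) \oc (0 : mor W Z0) = g \oc k by rewrite comp0l gk.
have [w [_ wk]] := dist_morphism triW ((dist_rotate _ _ _).1 tri) sq.
have [m em] := shift_full w; exists m; apply: shift_faithful.
by move: wk; rewrite -em fmap1 compNr compf1 compNl -fmapM => /oppr_inj.
Qed.

(** Compare with the triangle 0 -> W -> W, obtained by rotating the identity
    triangle of W backwards; that step needs 0[1] = 0. *)
Lemma exact_extend W (k : mor Y W) : k \oc f = 0 -> exists m, k = m \oc g.
Proof.
move=> kf; have [[Z0 Z0P] _] := tcat_additive C.
have triW : exact_tri (0 : mor Z0 W) (idm W) (0 : mor W (shiftF Z0)).
  apply/dist_rotate; rewrite shift0 oppr0.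
  exact: dist_id (shift_zero_object Z0P).
have sq : k \oc f = (0 : mor Z0 W) \oc (0 : mor X Z0) by rewrite kf comp0l.
have [w [wg _]] := dist_morphism tri triW sq.
by exists w; rewrite wg comp1f.
Qed.

End Exactness.

(** Comparison maps in opposite directions over the identities of X and Y need
    not be mutually inverse.  A composite e of the two satisfies e g = g and
    h e = h, so e - 1 factors on the right through h and is killed on the left
    by h: it is square-zero. *)
Lemma cone_isomorphic X Y Z Z' (f : mor X Y)
    (g : mor Y Z) (h : mor Z (shiftF X))
    (g' : mor Y Z') (h' : mor Z' (shiftF X)) :
  exact_tri f g h -> exact_tri f g' h' -> isomorphic Z Z'.
Proof.
move=> tri tri'.
have sq : idm Y \oc f = f \oc idm X by rewrite comp1f compf1.
have [w [wg hw]] := dist_morphism tri tri' sq.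
have [w' [w'g hw']] := dist_morphism tri' tri sq.
rewrite compf1 in wg; rewrite compf1 in w'g.
rewrite fmap1 comp1f in hw; rewrite fmap1 comp1f in hw'.
have nil Z1 (g1 : mor Y Z1) (h1 : mor Z1 (shiftF X)) (e : mor Z1 Z1) :
    exact_tri f g1 h1 -> e \oc g1 = g1 -> h1 \oc e = h1 ->
    (e - idm Z1) \oc (e - idm Z1) = 0.
  move=> tri1 eg he.
  have [|m em] := exact_extend ((dist_rotate _ _ _).1 tri1) (k := e - idm Z1).
    by rewrite compBl comp1f eg subrr.
  by rewrite {1}em -Defs.compA compBr compf1 he subrr comp0r.
exists w; apply: (is_iso_square_zero (g := w')).
  by apply: (nil _ _ _ _ tri); [rewrite -Defs.compA wg|rewrite Defs.compA -hw'].
by apply: (nil _ _ _ _ tri'); [rewrite -Defs.compA w'g|rewrite Defs.compA -hw].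
Qed.

End Triangles.

(** * Semi-orthogonality *)

Lemma factors_through_iso_closure (C : triangulated) (P : set C) (W X Y : C)
    (g : mor W Y) (f : mor X W) :
  iso_closure P W -> factors_through P (g \oc f).
Proof.
case=> W' PW' [i [j [ji _]]]; exists W'; split=> //.
by exists (g \oc j), (i \oc f); rewrite -Defs.compA (Defs.compA j) ji comp1f.
Qed.

Section SemiOrthogonality.
Variables (C : triangulated) (A B : set C) (sod : semi_orthogonal A B).

Lemma sod_hom0 (X Y : C) (f : mor Y X) : A X -> B Y -> f = 0.
Proof. by case: sod => _ _ h _ AX BY; apply: h. Qed.

Lemma sod_hom_shift0 (X Y : C) (f : mor Y (shiftF X)) : A X -> B Y -> f = 0.
Proof.
case: sod => -[_ _ shiftA _ _] _ h _ /shiftA [X' AX' [i [j [ji _]]]] BY.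
by rewrite -[f]comp1f -ji -Defs.compA (h _ _ AX' BY (i \oc f)) comp0r.
Qed.

(** The two halves of the definition of J enter separately: factoring through A
    kills what comes from B, and factoring through B kills what goes to A[1]. *)
Lemma sod_ideal_mulr0 (X Y Z : C) (c : mor Y Z) (f : mor X Y) :
  ideal_mem (sod_ideal sod) c -> B X -> c \oc f = 0.
Proof.
case=> -[W [AW [g [h ->]]]] _ BX.
by rewrite -Defs.compA (sod_hom0 (h \oc f) AW BX) comp0r.
Qed.

Lemma sod_ideal_mull0 (X Y Z : C) (g : mor Y (shiftF Z)) (c : mor X Y) :
  ideal_mem (sod_ideal sod) c -> A Z -> g \oc c = 0.
Proof.
case=> _ [W [BW [k [h ->]]]] AZ.
by rewrite Defs.compA (sod_hom_shift0 (g \oc k) AZ BW) comp0l.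
Qed.

Lemma sod_ideal_square0 (X Y Z : C) (g : mor Y Z) (f : mor X Y) :
    ideal_mem (sod_ideal sod) g -> ideal_mem (sod_ideal sod) f ->
  g \oc f = 0.
Proof.
move=> Jg [_ [W [BW [k [h ->]]]]].
by rewrite Defs.compA (sod_ideal_mulr0 k Jg BW) comp0l.
Qed.

End SemiOrthogonality.

(** * The cone functor *)

Section HomElementsTheory.
Variables (C : preadditive) (A B : set C).
Local Notation El := (elements (hom_bimodule A B)).

Lemma arr_square (u v : El) (p : mor u v) :
  arr_snd p \oc arr u = arr v \oc arr_fst p.
Proof.
have /eqP := el_pairP p; rewrite /= /hom_bimap /=.
by rewrite [LHS]comp1f (compf1 (el_val u)) => ->.
Qed.

Lemma arr_morphism (u v : El) (a : mor (arr_src u) (arr_src v))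
    (b : mor (arr_tgt u) (arr_tgt v)) :
  b \oc arr u = arr v \oc a ->
  exists p : mor u v, arr_fst p = a /\ arr_snd p = b.
Proof.
move=> e; have abP : (a, b) \in @el_pred _ _ (hom_bimodule A B) u v.
  rewrite unfold_in /= /hom_bimap /=; apply/eqP.
  by rewrite [LHS]comp1f (compf1 (el_val u)) -[LHS]e.
by exists (ElHom abP).
Qed.

Lemma arr_ext (u v : El) (p q : mor u v) :
  arr_fst p = arr_fst q -> arr_snd p = arr_snd q -> p = q.
Proof.
move=> e1 e2; apply: val_inj.
by rewrite [LHS]surjective_pairing [RHS]surjective_pairing; congr pair.
Qed.

End HomElementsTheory.

Section ConeFunctor.
Variables (C : triangulated) (A B : set C) (sod : semi_orthogonal A B).
Local Notation El := (elements (hom_bimodule A B)).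
Local Notation J := (sod_ideal sod).
Variable cone : El -> C.
Variable f1 : forall u : El, mor (arr_tgt u) (cone u).
Variable f2 : forall u : El, mor (cone u) (shiftF (arr_src u)).
Hypothesis cone_dist : forall u : El, exact_tri (arr u) (f1 u) (f2 u).

(** A relation rather than a function: c is any completion of the square p to a
    morphism of triangles.  Being stable under composition, it makes
    functoriality immediate once completions are unique modulo J. *)
Definition cone_map (u v : El) (p : mor u v) (c : mor (cone u) (cone v)) :=
  c \oc f1 u = f1 v \oc arr_snd p /\
  fmap shiftF (arr_fst p) \oc f2 u = f2 v \oc c.

Lemma arr_srcP (u : El) : A (arr_src u). Proof. exact: svalP (el_src u). Qed.
Lemma arr_tgtP (u : El) : B (arr_tgt u). Proof. exact: svalP (el_tgt u). Qed.

Lemma cone_map_exists (u v : El) (p : mor u v) : exists c, cone_map p c.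
Proof. exact: dist_morphism (cone_dist u) (cone_dist v) (arr_square p). Qed.

Lemma cone_map1 (u : El) : cone_map (idm u) (idm (cone u)).
Proof.
by split; rewrite /arr_fst /arr_snd /= ?fmap1 ?comp1f compf1.
Qed.

Lemma cone_mapM (u v w : El) (q : mor v w) (p : mor u v) c d :
  cone_map q d -> cone_map p c -> cone_map (q \oc p) (d \oc c).
Proof.
case=> d1 d2 [c1 c2]; split.
  by rewrite -Defs.compA c1 Defs.compA d1 -Defs.compA.
have -> : arr_fst (q \oc p) = arr_fst q \oc arr_fst p by [].
by rewrite fmapM -Defs.compA c2 Defs.compA d2 -Defs.compA.
Qed.

(** The difference of two completions is killed by f1 u and by f2 v, so it
    factors through A[1] and through B. *)
Lemma cone_map_unique (u v : El) (p : mor u v) c d :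
  cone_map p c -> cone_map p d -> ideal_mem J (c - d).
Proof.
case=> c1 c2 [d1 d2].
have [m em] : exists m, c - d = m \oc f2 u.
  apply: (exact_extend ((dist_rotate _ _ _).1 (cone_dist u))).
  by rewrite compBl c1 d1 subrr.
have [n en] : exists n, c - d = f1 v \oc n.
  apply: (exact_lift ((dist_rotate _ _ _).1 (cone_dist v))).
  by rewrite compBr -c2 -d2 subrr.
split; last first.
  by rewrite en; exists (arr_tgt v); split; [exact: arr_tgtP|exists (f1 v), n].
rewrite em; apply: factors_through_iso_closure.
by case: sod => -[_ _ shiftA _ _] _ _ _; apply/shiftA/arr_srcP.
Qed.

(** The obstruction to restricting c along f1 u is a morphism from B to A[1]. *)
Lemma cone_map_full (u v : El) (c : mor (cone u) (cone v)) :
  exists p : mor u v, cone_map p c.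
Proof.
have tu := (dist_rotate _ _ _).1 (cone_dist u).
have tv := (dist_rotate _ _ _).1 (cone_dist v).
have [b eb] : exists b, c \oc f1 u = f1 v \oc b.
  apply: (exact_lift tv).
  exact: sod_hom_shift0 sod _ _ _ (arr_srcP v) (arr_tgtP u).
have [w [wf2 sq]] := dist_morphism tu tv eb.
have [a ea] := shift_full w; rewrite -{w}ea in wf2 sq.
have [p [pa pb]] : exists p : mor u v, arr_fst p = a /\ arr_snd p = b.
  apply: arr_morphism; apply: shift_faithful.
  by move: sq; rewrite compNr compNl -!fmapM => /oppr_inj.
by exists p; rewrite /cone_map pa pb.
Qed.

(** Stated for two completions with difference in J, this avoids subtracting
    morphisms of squares.  Exactness exhibits the differences of the components
    of p and q as multiples of morphisms from B to A or from B[1] to A[1]. *)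
Lemma cone_map_faithful (u v : El) (p q : mor u v) c d :
  cone_map p c -> cone_map q d -> ideal_mem J (c - d) -> p = q.
Proof.
case=> c1 c2 [d1 d2] Jcd; apply: arr_ext; last first.
  apply/eqP; rewrite -subr_eq0; apply/eqP.
  have [|m ->] := exact_lift (cone_dist v) (k := arr_snd p - arr_snd q).
    rewrite compBr -c1 -d1 -compBl; apply: sod_ideal_mulr0 Jcd _.
    exact: arr_tgtP.
  by rewrite (sod_hom0 sod m (arr_srcP v) (arr_tgtP u)) comp0r.
apply: shift_faithful; apply/eqP; rewrite -subr_eq0; apply/eqP.
(* Two rotations put f2 u first, followed by - (arr u)[1], so that what f2 u
   kills extends to B[1]. *)
have tri := (dist_rotate _ _ _).1 ((dist_rotate _ _ _).1 (cone_dist u)).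
have [|m ->] := exact_extend tri
    (k := fmap shiftF (arr_fst p) - fmap shiftF (arr_fst q)).
  rewrite compBl c2 d2 -compBr; apply: sod_ideal_mull0 Jcd _.
  exact: arr_srcP.
have [m' <-] := shift_full m.
by rewrite (sod_hom0 sod m' (arr_srcP v) (arr_tgtP u)) shift0 comp0l.
Qed.

Lemma cone_dense (T : C) : exists u : El, isomorphic (cone u) T.
Proof.
case: sod => _ _ _ /(_ T) [X [Y [AX BY [f [g [h tri]]]]]].
pose u : El := @Defs.El _ _ (hom_bimodule A B) (exist _ X AX) (exist _ Y BY) f.
by exists u; apply: cone_isomorphic (cone_dist u) tri.
Qed.

Definition cone_fmap (u v : El) (p : mor u v) :
    @mor (quotient_cat J) (cone u) (cone v) :=
  quotient_class J (sval (cid (cone_map_exists p))).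

Lemma cone_fmapE (u v : El) (p : mor u v) c :
  cone_map p c -> cone_fmap p = quotient_class J c.
Proof.
by move=> pc; apply/qpi_eq/(cone_map_unique _ pc); apply: (svalP (cid _)).
Qed.

Lemma cone_fmap1 (u : El) :
  cone_fmap (idm u) = @idm (quotient_cat J) (cone u).
Proof. exact: cone_fmapE (cone_map1 u). Qed.

Lemma cone_fmapM (u v w : El) (q : mor v w) (p : mor u v) :
  cone_fmap (q \oc p) = cone_fmap q \oc cone_fmap p.
Proof.
have [c pc] := cone_map_exists p; have [d qd] := cone_map_exists q.
rewrite (cone_fmapE (cone_mapM qd pc)) (cone_fmapE pc) (cone_fmapE qd).
by rewrite /= qcompE.
Qed.

Definition cone_functor : functor El (quotient_cat J) :=
  Functor (FunctorOn cone_fmap1 cone_fmapM).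

Lemma cone_functor_full : full_functor cone_functor.
Proof.
move=> u v q; have [c ->] := qpiK q; have [p pc] := cone_map_full c.
by exists p; apply: cone_fmapE.
Qed.

Lemma cone_functor_faithful : faithful_functor cone_functor.
Proof.
move=> u v p q; have [c pc] := cone_map_exists p.
have [d qd] := cone_map_exists q.
rewrite [fmap _ p](cone_fmapE pc) [fmap _ q](cone_fmapE qd) => /qpi_eq.
exact: cone_map_faithful pc qd.
Qed.

Lemma cone_isomorphicE (u v : El) :
  isomorphic (cone u) (cone v) <-> isomorphic u v.
Proof.
have [full faithful] := (cone_functor_full, cone_functor_faithful).
rewrite -(fully_faithful_isomorphic _ _ full faithful).
by rewrite quotient_isomorphic //; apply: sod_ideal_square0.
Qed.

Lemma cone_functor_equivalence : is_equivalence cone_functor.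
Proof.
apply: fully_faithful_dense_equivalence => [||T].
- exact: cone_functor_full.
- exact: cone_functor_faithful.
have [u iuT] := cone_dense T; exists u.
by apply/quotient_isomorphic => //; apply: sod_ideal_square0.
Qed.

End ConeFunctor.

(** * Isomorphism classes *)

(** Phi S is the union of the classes of F u for u in S, so that no
    representatives are chosen; on a class this union is a single class. *)
Lemma iso_classes_bij (C D : preadditive) (F : C -> D) :
    (forall u v, isomorphic (F u) (F v) <-> isomorphic u v) ->
    (forall T, exists u, isomorphic (F u) T) ->
  exists Phi : set C -> set D,
    (forall u, Phi (iso_class u) = iso_class (F u)) /\
    set_bij (@iso_classes C) (@iso_classes D) Phi.
Proof.
move=> Fiso Fdense.
pose Phi (S : set C) : set D := \bigcup_(u in S) iso_class (F u).
have PhiE u : Phi (iso_class u) = iso_class (F u).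
  apply/seteqP; split=> [T [v uv]|T]; last first.
    by exists u => //; apply: isomorphic_refl.
  by apply: isomorphic_trans; apply/Fiso.
exists Phi; split=> //; split.
- by move=> _ [u _ <-]; exists (F u).
- move=> S S' /set_mem [u _ <-] /set_mem [v _ <-].
  by rewrite !PhiE => /iso_class_eq /Fiso /iso_class_eq.
- move=> _ [T _ <-]; have [u iuT] := Fdense T.
  by exists (iso_class u); [exists u|rewrite PhiE; apply/iso_class_eq].
Qed.

Theorem theorem5p1 (C : triangulated) (A B : set C)
    (sod : semi_orthogonal A B)
    (cone : elements (hom_bimodule A B) -> C)
    (f1 : forall u : elements (hom_bimodule A B), mor (arr_tgt u) (cone u))
    (f2 : forall u : elements (hom_bimodule A B),
        mor (cone u) (shiftF (arr_src u)))
    (cone_dist : forall u : elements (hom_bimodule A B),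
        exact_tri (arr u) (f1 u) (f2 u)) :
  [/\ exists F : @functor_on (elements (hom_bimodule A B))
                   (quotient_cat (sod_ideal sod)) cone,
        (forall (u v : elements (hom_bimodule A B)) (p : mor u v)
            (c : mor (cone u) (cone v)),
          c \oc f1 u = f1 v \oc arr_snd p ->
          fmap shiftF (arr_fst p) \oc f2 u = f2 v \oc c ->
          fmap_on F p = quotient_class (sod_ideal sod) c) /\
        is_equivalence (Functor F),
      forall (X Y : C) (h : mor X Y),
        ideal_mul (sod_ideal sod) (sod_ideal sod) h -> h = 0
    & exists Phi : set (elements (hom_bimodule A B)) -> set C,
        (forall u : elements (hom_bimodule A B),
          Phi (iso_class u) = iso_class (cone u)) /\
        set_bij (@iso_classes (elements (hom_bimodule A B)))
                (@iso_classes C) Phi].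
Proof.
split.
- exists (fon (cone_functor sod cone_dist)); split.
    by move=> u v p c c1 c2; apply: cone_fmapE.
  exact: cone_functor_equivalence.
- move=> X Y h [n [Z [g [f [Jg Jf ->]]]]].
  by apply: big1 => i _; apply: sod_ideal_square0 (Jg i) (Jf i).
- apply: iso_classes_bij; first exact: cone_isomorphicE.
  exact: cone_dense.
Qed.
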